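(* There exist algorithms that, given an $n$-element set $U$ and functions $f,g,h:\binom{U}{q}\to\mathbb{Z}$, compute $$\Delta(f,g,h)=\sum_{\substack{A,B,C\in\binom{U}{q}\\ A\cap B=A\cap C=B\cap C=\emptyset}} f(A)\,g(B)\,h(C)$$ (the weighted disjoint triples problem) (1) for $q=2$ in $O(n^{\omega})$ arithmetic operations; (2) for $q=3$ in $O(n^{\omega+1})$ arithmetic operations; and (3) for $q=4$ in $O(n^{2\omega})$ arithmetic operations.
   Context: $\binom{U}{q}$ denotes the set of all $q$-element subsets of $U$. Arithmetic operations are addition, subtraction, multiplication, and exact division of integers. $\omega$ is the limiting exponent of square matrix multiplication, $2\leq\omega<2.3728639$. Convention: the product of two $N\times N$ matrices is taken to be computable in $O(N^{\omega})$ arithmetic operations, and the product of an $N\times M$ matrix with an $M\times N$ matrix, $M\geq N$, in $O(N^{\omega-1}M)$ arithmetic operations. *)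

(* Defs.v *)
From mathcomp Require Import all_boot all_order all_algebra.
From mathcomp Require Import classical_sets reals exp.

Set Implicit Arguments.
Unset Strict Implicit.
Unset Printing Implicit Defensive.

Import Order.TTheory GRing.Theory Num.Theory.
Local Open Scope ring_scope.

(* Algorithms measured in arithmetic operations are straight-line programs
   over the integers.  The inputs are indexed by I, the outputs by O.  Each
   instruction performs one operation and stores its result in the next
   register: the k-th instruction (from 0) writes register k.  The only free
   constant is 1; any other constant has to be computed. *)

Inductive arith_op := Add | Sub | Mul | Div.

Inductive operand (I : Type) := Input of I | Reg of nat | One.
Arguments Reg {I}.
Arguments One {I}.

Record instr (I : Type) :=
  Instr { op : arith_op; arg1 : operand I; arg2 : operand I }.

Record slp (I O : Type) :=
  Slp { code : seq (instr I); output : O -> operand I }.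

(* Division is only defined when it is exact, with a nonzero divisor. *)
Definition apply_op (o : arith_op) (a b : int) : option int :=
  match o with
  | Add => Some (a + b)
  | Sub => Some (a - b)
  | Mul => Some (a * b)
  | Div => if (b != 0) && (b %| a)%Z then Some (a %/ b)%Z else None
  end.

Definition value (I : Type) (x : I -> int) (regs : seq int) (v : operand I) :
    option int :=
  match v with
  | Input i => Some (x i)
  | Reg k => onth regs k
  | One => Some 1
  end.

Definition exec_instr (I : Type) (x : I -> int) (regs : seq int) (c : instr I) :
    option (seq int) :=
  if value x regs (arg1 c) is Some a then
    if value x regs (arg2 c) is Some b then
      omap (rcons regs) (apply_op (op c) a b)
    else None
  else None.

Definition run (I : Type) (x : I -> int) (cs : seq (instr I)) :
    option (seq int) :=
  foldl (fun st c => obind (fun regs => exec_instr x regs c) st) (Some [::]) cs.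

Definition cost (I O : Type) (P : slp I O) : nat := size (code P).

(* In particular no division of P is undefined, whatever the input. *)
Definition computes (I O : Type) (P : slp I O)
    (F : (I -> int) -> O -> int) : Prop :=
  forall x : I -> int, exists2 regs : seq int,
    run x (code P) = Some regs &
    forall o : O, value x regs (output P o) = Some (F x o).

Definition mx_input (N M : nat) : Type := ('I_N * 'I_M + 'I_M * 'I_N)%type.

Definition mx_product (N M : nat) (x : mx_input N M -> int)
    (o : 'I_N * 'I_N) : int :=
  ((\matrix_(i < N, k < M) x (inl (i, k))) *m
   (\matrix_(k < M, j < N) x (inr (k, j)))) o.1 o.2.

(* N x N matrices can be multiplied in O(N^w) operations.  In this and the
   following bounds size 0 is only excluded from the cost estimate. *)
Definition square_mm_in (R : realType) (w : R) : Prop :=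
  exists (C : R) (P : forall N : nat, slp (mx_input N N) ('I_N * 'I_N)),
    forall N : nat,
      computes (P N) (@mx_product N N) /\
      ((0 < N)%N -> (cost (P N))%:R <= C * N%:R `^ w).

(* N x M by M x N products, M >= N, in O(N^(w-1) M) operations, with a
   constant uniform in N and M. *)
Definition rect_mm_in (R : realType) (w : R) : Prop :=
  exists (C : R) (P : forall N M : nat, slp (mx_input N M) ('I_N * 'I_N)),
    forall N M : nat, (N <= M)%N ->
      computes (P N M) (@mx_product N M) /\
      ((0 < N)%N -> (cost (P N M))%:R <= C * (N%:R `^ (w - 1) * M%:R)).

Definition omega (R : realType) : R := inf [set w : R | square_mm_in w]%classic.

Notation qset U q := {A : {set U} | #|A| == q}.

Definition Delta (U : finType) (q : nat) (f g h : qset U q -> int) : int :=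
  \sum_(A : qset U q) \sum_(B : qset U q) \sum_(C : qset U q |
      [&& [disjoint val A & val B], [disjoint val A & val C]
        & [disjoint val B & val C]])
    f A * g B * h C.

Definition triples_input (U : finType) (q : nat) : Type :=
  (qset U q + qset U q + qset U q)%type.

Definition triples_problem (U : finType) (q : nat)
    (x : triples_input U q -> int) (_ : unit) : int :=
  Delta (fun A => x (inl (inl A))) (fun B => x (inl (inr B)))
        (fun C => x (inr C)).

(* O(n^e) operations, n = #|U|, with a constant independent of U. *)
Definition disjoint_triples_in (R : realType) (q : nat) (e : R) : Prop :=
  exists (C : R) (P : forall U : finType, slp (triples_input U q) unit),
    forall (n : nat) (U : finType), #|U| = n ->
      computes (P U) (@triples_problem U q) /\
      ((0 < n)%N -> (cost (P U))%:R <= C * n%:R `^ e).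

(* Main.v *)
Require Import Defs.
From mathcomp Require Import all_boot all_order all_algebra.
From mathcomp Require Import boolp classical_sets reals exp.
From mathcomp Require Import zify ring lra.

(* For bits a, b, c one has [a + b + c <= 1] = 1 - ab - ac - bc + 2abc.  Taking
   the product over the points of U expands the disjointness of A, B, C into a
   sum over pairwise disjoint T, P, Q, R of 2^|T| (-1)^(|P|+|Q|+|R|) times the
   indicators of T + P + Q <= A, T + P + R <= B and T + Q + R <= C.  For fixed T
   and sizes of P, Q, R, the sum over A, B, C is that of the products
   a(P,Q) b(P,R) c(Q,R).  If M is the largest of the three sizes and m the next
   one, then m + M <= q - |T|, and this sum is evaluated by one n^m x n^M x n^m
   matrix product in O(n^(m(w-1)+M)) operations.  Over all T this costs at most
   n^(|T|+m+M+m(w-2)) <= n^(q+floor(q/2)(w-2)), which is n^w, n^(w+1) and n^(2w)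
   for q = 2, 3, 4. *)

Set Implicit Arguments.
Unset Strict Implicit.
Unset Printing Implicit Defensive.

Import Order.TTheory GRing.Theory Num.Theory.
Local Open Scope ring_scope.

(** * Composing straight-line programs and counting their instructions *)

Lemma run_rcons (I : Type) (x : I -> int) cs c :
  run x (rcons cs c) = obind (fun regs => exec_instr x regs c) (run x cs).
Proof. by rewrite /run foldl_rcons. Qed.

Section Makes.
Variable I : Type.
Local Notation fn := ((I -> int) -> int).
Implicit Types (L E : seq fn) (F G : fn) (S T V : set fn).

(* A register is represented by the function of the input that it holds. *)
Definition avail L F : Prop :=
  exists v : operand I, forall x, value x [seq f x | f <- L] v = Some (F x).

Definition realized L : Prop :=
  exists2 cs : seq (instr I), size cs = size L &
    forall x, run x cs = Some [seq f x | f <- L].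

(* Every program that has the functions in S available can be extended by at
   most c instructions so as to have those in T available as well. *)
Definition makes S (c : nat) T : Prop :=
  forall L, realized L -> (forall F, S F -> avail L F) ->
  exists E, [/\ (size E <= c)%N, realized (L ++ E) &
                forall F, T F -> avail (L ++ E) F].

Lemma avail_cat L E F : avail L F -> avail (L ++ E) F.
Proof.
case=> v vP; exists v => x; move: (vP x); case: v {vP} => //= k.
elim: L k => [|f L IHL] [|k] //=; exact: IHL.
Qed.

Lemma avail_mem L E F : avail (L ++ F :: E) F.
Proof. by exists (Reg (size L)) => x; elim: L. Qed.

Lemma realized_rcons o L F G H : realized L -> avail L F -> avail L G ->
  (forall x, apply_op o (F x) (G x) = Some (H x)) -> realized (rcons L H).
Proof.
case=> cs szcs csP [v vP] [w wP] oP.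
exists (rcons cs (Instr o v w)) => [|x]; first by rewrite !size_rcons szcs.
by rewrite run_rcons csP /= /exec_instr /= vP wP oP /= map_rcons.
Qed.

Lemma makes_op o S F G H : S F -> S G ->
  (forall x, apply_op o (F x) (G x) = Some (H x)) -> makes S 1 [set H]%classic.
Proof.
move=> SF SG oP L rL SL; exists [:: H]; split=> //.
  by rewrite cats1; apply: (realized_rcons rL (SL _ SF) (SL _ SG) oP).
by move=> _ ->; apply: avail_mem.
Qed.

Lemma makes_sub S S' c c' T T' :
  (S `<=` S')%classic -> (c <= c')%N -> (T' `<=` T)%classic ->
  makes S c T -> makes S' c' T'.
Proof.
move=> sS lc sT mk L rL SL.
have [|E [szE rE TE]] := mk L rL; first by move=> F /sS /SL.
by exists E; split=> [||F /sT /TE//] //; apply: leq_trans lc.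
Qed.

Lemma makes0 S T : (T `<=` S)%classic -> makes S 0 T.
Proof. by move=> sT L rL SL; exists [::]; rewrite cats0; split=> // F /sT /SL. Qed.

Lemma makes_seq S c T d V :
  makes S c T -> makes (S `|` T)%classic d V -> makes S (c + d) (T `|` V)%classic.
Proof.
move=> mT mV L rL SL; have [E [szE rE TE]] := mT L rL SL.
have [|E' [szE' rE' VE']] := mV _ rE.
  by move=> F [/SL/avail_cat|/TE].
exists (E ++ E'); rewrite size_cat leq_add // catA; split=> // F [|/VE'//].
by move=> /TE/avail_cat.
Qed.

Lemma makes_trans S c T d V :
  makes S c T -> makes (S `|` T)%classic d V -> makes S (c + d) V.
Proof.
by move=> mT mV; apply: makes_sub (makes_seq mT mV) => //; right.
Qed.

(** Inputs are operands in their own right, so reading them costs no instruction. The same holds for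
    the constant 1 in [makes_one]. *)
Lemma makes_input (x0 := fun i => fun x : I -> int => x i) S c T :
  makes (S `|` range x0)%classic c T -> makes S c T.
Proof.
move=> mk L rL SL; apply: mk => // F [/SL//|[i _ <-]].
by exists (Input i).
Qed.

Lemma makes_one S c T : makes (S `|` [set fun=> 1])%classic c T -> makes S c T.
Proof.
by move=> mk L rL SL; apply: mk => // F [/SL//|->]; exists One.
Qed.

Lemma makes_family (J : eqType) S (s : seq J) (c : J -> nat) (F : J -> fn) :
  (forall j, j \in s -> makes S (c j) [set F j]%classic) ->
  makes S (\sum_(j <- s) c j) [set F j | j in [set` s]]%classic.
Proof.
elim: s => [|j s IHs] mF.
  by rewrite big_nil; apply: makes0 => f [i] /=; rewrite in_nil.
pose T := [set F j | j in [set` s]]%classic.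
rewrite big_cons.
apply: makes_sub (makes_seq (mF j _) (_ : makes _ (\sum_(j <- s) c j) T)) => //.
- move=> f [i]; rewrite /= inE => /orP[/eqP->|si] <-; first by left.
  by right; exact: imageP.
- by rewrite inE eqxx.
apply: makes_sub (IHs _) => // i si.
by apply: mF; rewrite inE si orbT.
Qed.

(** Starting from an available zero costs one addition per term and also covers the empty sum, which
    takes no instruction. *)
Lemma makes_sum (J : eqType) S (s : seq J) (F : J -> fn) :
  S (fun=> 0) -> (forall j, j \in s -> S (F j)) ->
  makes S (size s) [set fun x => \sum_(j <- s) F j x]%classic.
Proof.
move=> S0; elim: s => [|j s IHs] SF /=.
  by apply: makes0 => _ ->; rewrite (_ : (fun _ => _) = fun=> 0)//;
     apply/funext => x; rewrite big_nil.
rewrite -addn1; apply: makes_trans (IHs _) _.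
  by move=> i si; apply: SF; rewrite inE si orbT.
apply: (@makes_op Add _ (F j) (fun x => \sum_(j <- s) F j x)).
- by left; apply: SF; rewrite inE eqxx.
- by right.
- by move=> x /=; rewrite big_cons.
Qed.

Lemma makes_mul S F G : S F -> S G ->
  makes S 1 [set fun x => F x * G x]%classic.
Proof. by move=> SF SG; apply: (@makes_op Mul _ F G). Qed.

Lemma makes_zero S : makes S 1 [set fun=> 0]%classic.
Proof.
by apply: makes_one; apply: (@makes_op Defs.Sub _ (fun=> 1) (fun=> 1)) => //; right.
Qed.

(** Only 1 is free, so [z] is built by repeated addition of 1, and one last operation settles its
    sign. The linear cost is harmless: the only constants needed are values of [coef] at sizes
    bounded by q, which do not depend on n. *)
Lemma makes_const S (z : int) : S (fun=> 0) ->
  makes S (`|z|%N).+1 [set fun=> z]%classic.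
Proof.
move=> S0; apply: makes_one; rewrite -addn1.
apply: (@makes_trans _ _ [set fun=> `|z|%N%:Z]%classic).
  have <- : (fun _ : I -> int => \sum_(j <- iota 0 `|z|%N) 1) = fun=> `|z|%N%:Z.
    apply/funext => x.
    by rewrite big_const_seq count_predT size_iota iter_addr addr0 -natz.
  rewrite -[X in makes _ X](size_iota 0 `|z|%N).
  by apply: makes_sum => [|j _]; [left | right].
case: z => k.
  apply: (@makes_op Add _ (fun=> k) (fun=> 0)) => [||x]; [by right|by left; left|].
  by rewrite /= addr0.
apply: (@makes_op Defs.Sub _ (fun=> 0) (fun=> k.+1)) => [||x].
- by left; left.
- by right.
- by rewrite /= sub0r.
Qed.

(** This is a subroutine call: the code of [P] is copied after the existing registers, its inputs
    being replaced by the available functions [y]. *)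
Lemma makes_subst (I0 O : Type) (P : slp I0 O) (phi : (I0 -> int) -> O -> int)
    S (y : I0 -> fn) :
  computes P phi -> (forall i, S (y i)) ->
  makes S (cost P) [set (fun x => phi (y^~ x) o) | o in setT]%classic.
Proof.
move=> cP Sy L rL SL.
pose val E x v := value (y^~ x) [seq f x | f <- E] v.
have availE E v : (forall x, val E x v) ->
    avail (L ++ E) (fun x => odflt 0 (val E x v)).
  move=> vE; case: v vE => [i|k|] vE; last by exists One.
    by have /(@avail_cat L E)[v vP] := SL _ (Sy i); exists v.
  (* Register k of the copied program comes after all registers of [L]. *)
  exists (Reg (size L + k)) => x; move: (vE x); rewrite /val /=.
  rewrite map_cat; elim: (L) => [|f l IHl] //=.
  by case: onth.
suff [E [szE rE EP]] : exists E, [/\ size E = cost P, realized (L ++ E) &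
    forall x, run (y^~ x) (code P) = Some [seq f x | f <- E]].
  exists E; rewrite szE; split=> // _ [o _ <-].
  have oE x : val E x (output P o) = Some (phi (y^~ x) o).
    by have [regs runP outP] := cP (y^~ x); move: runP (outP o); rewrite EP => -[<-].
  have [v vP] := availE E (output P o)
    (fun x => etrans (congr1 isSome (oE x)) erefl).
  by exists v => x; rewrite vP oE.
(* The induction on the code only needs that the run is defined on every input, a property inherited
   by prefixes. It also ensures that the default 0 of [odflt] is never taken below. *)
have : forall x, run (y^~ x) (code P) by move=> x; have [regs ->] := cP (y^~ x).
rewrite /cost; elim/last_ind: (code P) => [|cs c IH] runP.
  by exists [::]; rewrite cats0.
have [|E [szE rE EP]] := IH.
  by move=> x; move: (runP x); rewrite run_rcons; case: run.
have {}runP x : exec_instr (y^~ x) [seq f x | f <- E] c.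
  by move: (runP x); rewrite run_rcons EP.
pose a v x := odflt 0 (val E x v).
pose F x := odflt 0 (apply_op (op c) (a (arg1 c) x) (a (arg2 c) x)).
have v1 x : val E x (arg1 c).
  by move: (runP x); rewrite /exec_instr /val; case: value.
have v2 x : val E x (arg2 c).
  by move: (runP x); rewrite /exec_instr /val; do 2! case: value => //.
have execE x : apply_op (op c) (a (arg1 c) x) (a (arg2 c) x) = Some (F x).
  move: (runP x) (v1 x) (v2 x); rewrite /F /a /exec_instr /val.
  by case: value => // u; case: value => // w; case: apply_op.
exists (rcons E F); rewrite !size_rcons szE; split=> // [|x].
  rewrite -rcons_cat.
  exact: (realized_rcons rE (availE _ _ v1) (availE _ _ v2) execE).
rewrite run_rcons EP /= map_rcons -[in RHS]/(F x).
move: (execE x) (v1 x) (v2 x); rewrite /exec_instr /a /val.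
by case: value => // u; case: value => // w /= ->.
Qed.

Lemma makes_slp c F : makes set0 c [set F]%classic ->
  exists2 P : slp I unit, computes P (fun x _ => F x) & (cost P <= c)%N.
Proof.
move=> mk; have [||E [szE [cs szcs csP] FE]] := mk [::]; [by exists [::]|by []|].
have [v vP] := FE _ (erefl F).
exists (Slp cs (fun=> v)); last by rewrite /cost /= szcs.
by move=> x; exists [seq f x | f <- E].
Qed.

End Makes.

(** * Weighted triangle sums by one matrix product *)

(** Padding by zeros lets a list of length at most N be indexed by the rows or columns of a matrix
    of fixed size. *)
Lemma sum_onth (V : nmodType) (X : Type) (s : seq X) (N : nat) (F : X -> V) :
  (size s <= N)%N ->
  \sum_(i < N) oapp F 0 (onth s i) = \sum_(x <- s) F x.
Proof.
elim: N s => [|N IHN] [|x s] //=; rewrite ?big_ord0 ?big_nil //.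
  by move=> _; apply: big1 => i _; rewrite onth0n.
by move=> sN; rewrite big_ord_recl big_cons -IHN.
Qed.

(** The sum over x is entry (y, z) of the product of the matrices [a] (rows y, columns x) and [b]
    (rows x, columns z). Each of the N^2 entries is then multiplied by [c y z], and the results are
    added, which accounts for the term 2 N^2. *)
Lemma makes_triangle (I X Y Z : Type) (S : set ((I -> int) -> int))
    (sX : seq X) (sY : seq Y) (sZ : seq Z)
    (a : X -> Y -> (I -> int) -> int) (b : X -> Z -> (I -> int) -> int)
    (c : Y -> Z -> (I -> int) -> int)
    N M (P : slp (mx_input N M) ('I_N * 'I_N)) :
  computes P (@mx_product N M) ->
  (size sX <= M)%N -> (size sY <= N)%N -> (size sZ <= N)%N ->
  S (fun=> 0) -> (forall x y, S (a x y)) -> (forall x z, S (b x z)) ->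
  (forall y z, S (c y z)) ->
  makes S (cost P + 2 * N ^ 2)
    [set fun v => \sum_(x <- sX) \sum_(y <- sY) \sum_(z <- sZ)
                    a x y v * b x z v * c y z v]%classic.
Proof.
move=> cP leX leY leZ S0 Sa Sb Sc.
pose z0 (v : I -> int) : int := 0.
(* Positions beyond the end of a list hold the zero function, so that the matrices have exactly the
   sizes that [P] expects. *)
pose a' i k := oapp (fun y => oapp (a^~ y) z0 (onth sX k)) z0 (onth sY i).
pose b' k j := oapp (fun z => oapp (b^~ z) z0 (onth sX k)) z0 (onth sZ j).
pose c' i j := oapp (fun y => oapp (c y) z0 (onth sZ j)) z0 (onth sY i).
pose y0 (ik : mx_input N M) :=
  match ik with inl (i, k) => a' i k | inr (k, j) => b' k j end.
have Sy ik : S (y0 ik).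
  by case: ik => -[i k]; rewrite /= /a' /b'; do 2 case: onth => [?|] //=.
have Sc' i j : S (c' i j) by rewrite /c'; do 2 case: onth => [?|] //=.
pose d (ij : 'I_N * 'I_N) v := mx_product (y0^~ v) ij * c' ij.1 ij.2 v.
have -> : (fun v => \sum_(x <- sX) \sum_(y <- sY) \sum_(z <- sZ)
                    a x y v * b x z v * c y z v) =
    fun v => \sum_(ij <- enum {: 'I_N * 'I_N}) d ij v.
  apply/funext => v; rewrite big_enum /=.
  under [RHS]eq_bigr => ij _ do rewrite /d /mx_product mxE mulr_suml.
  rewrite [RHS]exchange_big /= -(sum_onth _ leX); apply: eq_bigr => k _.
  rewrite -(pair_bigA _ (fun i j => (\matrix_(i', k') y0 (inl (i', k')) v) i k *
     (\matrix_(k', j') y0 (inr (k', j')) v) k j * c' i j v)) /=.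
  case E : (onth sX k) => [x|] /=; last first.
    rewrite big1 // => i _; rewrite big1 // => j _.
    by rewrite !mxE /= /a' E; case: onth => [y|] /=; rewrite !mul0r.
  rewrite -(sum_onth _ leY); apply: eq_bigr => i _.
  case E' : (onth sY i) => [y|] /=; last first.
    by rewrite big1 // => j _; rewrite !mxE /= /a' E' /= !mul0r.
  rewrite -(sum_onth _ leZ); apply: eq_bigr => j _.
  rewrite !mxE /= /a' /b' /c' E E' /=.
  by case: (onth sZ j) => //=; rewrite mulr0.
apply: makes_trans (makes_subst cP Sy) _.
rewrite mul2n -addnn.
apply: (@makes_trans _ _ _
  [set d ij | ij in [set` enum {: 'I_N * 'I_N}]]%classic).
  have -> : (N ^ 2 = \sum_(ij <- enum {: 'I_N * 'I_N}) 1)%N.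
    by rewrite sum1_size -cardE card_prod card_ord.
  apply: makes_family => ij _; apply: makes_mul; last by left.
  by right; exact: imageP.
have {1}-> : (N ^ 2 = size (enum {: 'I_N * 'I_N}))%N.
  by rewrite -cardE card_prod card_ord.
by apply: makes_sum => [|ij eij]; [left; left | right; exact: imageP].
Qed.

(** * Expansion of the disjointness indicator *)

Section Expansion.
Variable U : finType.
Implicit Types A B C T P Q R : {set U}.

Lemma prod_nat_of_bool (b : pred U) : \prod_u (b u)%:R = [forall u, b u]%:R :> int.
Proof.
case: forallP => [bT|/forallP]; first by rewrite big1 // => u _; rewrite bT.
by rewrite negb_forall => /existsP[u /negPf bF]; rewrite (bigD1 u) //= bF mul0r.
Qed.

(** Distributivity: the set J collects the points at which the summand for [true] is chosen. *)
Lemma prod_sum_bool (G : U -> bool -> int) :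
  \prod_u \sum_(b : bool) G u b = \sum_(J : {set U}) \prod_u G u (u \in J).
Proof.
under eq_bigr => u _ do rewrite big_bool /=.
rewrite (bigA_distr _ _ (fun u => G u true) (fun u => G u false)).
by apply: eq_bigr => J _; apply: eq_bigr => u _; case: (u \in J).
Qed.

(** Disjointness is part of the condition because the expansion chooses four independent bits at
    each point. The three factors [fits T P Q A], [fits T P R B] and [fits T Q R C] together rule
    out every choice with two bits set. *)
Definition fits T P Q A :=
  [&& [disjoint T & P], [disjoint T & Q], [disjoint P & Q]
    & T :|: P :|: Q \subset A].

Definition fits_at (t p q a : bool) :=
  ~~ (t && p) && ~~ (t && q) && ~~ (p && q) && ((t || p || q) ==> a).

Lemma prod_fits T P Q A :
  \prod_u (fits_at (u \in T) (u \in P) (u \in Q) (u \in A))%:R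
  = (fits T P Q A)%:R :> int.
Proof.
rewrite prod_nat_of_bool /fits !finset.disjoints_subset; congr (nat_of_bool _)%:R.
apply/forallP/and4P => [H|[]]; last first.
  move=> /fintype.subsetP H1 /fintype.subsetP H2 /fintype.subsetP H3.
  move=> /fintype.subsetP H4 u; move: (H1 u) (H2 u) (H3 u) (H4 u).
  rewrite /fits_at !inE.
  by case: (u \in T); case: (u \in P); case: (u \in Q); case: (u \in A) => //=;
    do ?[by move=> /(_ isT) | move=> _].
split; apply/fintype.subsetP => u; move: (H u); rewrite /fits_at !inE;
by case: (u \in T); case: (u \in P); case: (u \in Q); case: (u \in A).
Qed.

Definition coef (t p q r : nat) : int := 2 ^+ t * (-1) ^+ (p + q + r).

Lemma disjoint_expansion A B C :
  [&& [disjoint A & B], [disjoint A & C] & [disjoint B & C]]%:R =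
  \sum_(T : {set U}) \sum_(P : {set U}) \sum_(Q : {set U}) \sum_(R : {set U})
    coef #|T| #|P| #|Q| #|R| *
    ((fits T P Q A)%:R * (fits T P R B)%:R * (fits T Q R C)%:R) :> int.
Proof.
pose w (t p q r : bool) : int := coef t p q r.
pose G u t p q r : int := w t p q r *
  ((fits_at t p q (u \in A))%:R * (fits_at t p r (u \in B))%:R *
   (fits_at t q r (u \in C))%:R).
have -> : [&& [disjoint A & B], [disjoint A & C] & [disjoint B & C]]%:R
    = \prod_u \sum_t \sum_p \sum_q \sum_r G u t p q r.
  transitivity (\prod_u (~~ [|| (u \in A) && (u \in B), (u \in A) && (u \in C) |
     (u \in B) && (u \in C)])%:R : int).
    rewrite prod_nat_of_bool !finset.disjoints_subset; congr (nat_of_bool _)%:R.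
    apply/and3P/forallP => [[]|H].
      move=> /fintype.subsetP H1 /fintype.subsetP H2 /fintype.subsetP H3 u.
      move: (H1 u) (H2 u) (H3 u); rewrite !inE.
      by case: (u \in A); case: (u \in B); case: (u \in C) => //=;
        do ?[by move=> /(_ isT) | move=> _].
    split; apply/fintype.subsetP => u; move: (H u); rewrite !inE;
    by case: (u \in A); case: (u \in B); case: (u \in C).
  (* The identity for bits, checked in all eight cases: t, p, q, r select the terms 2abc, -ab, -ac,
     -bc, and the term 1 arises when no bit is set. *)
  apply: eq_bigr => u _; rewrite !big_bool /= /G /w.
  by case: (u \in A); case: (u \in B); case: (u \in C).
rewrite prod_sum_bool; apply: eq_bigr => T _.
rewrite prod_sum_bool; apply: eq_bigr => P _.
rewrite prod_sum_bool; apply: eq_bigr => Q _.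
rewrite prod_sum_bool; apply: eq_bigr => R _.
rewrite /G !big_split /= !prod_fits; congr (_ * _).
have cardS (J : {set U}) : #|J| = (\sum_u (u \in J))%N.
  by rewrite -sum1_card big_mkcond; apply: eq_bigr => u _; case: (u \in J).
by rewrite !prodrXr !big_split /= -!cardS.
Qed.

End Expansion.

(** * The sum over triples in terms of slices, grouped by set sizes *)

Lemma mulr_sum3 (R : comPzRingType) (X Y Z : finType) (k : R)
    (F : X -> R) (G : Y -> R) (H : Z -> R) :
  k * ((\sum_x F x) * (\sum_y G y) * (\sum_z H z)) =
  \sum_x \sum_y \sum_z k * (F x * G y * H z).
Proof.
rewrite -mulrA mulr_suml mulr_sumr; apply: eq_bigr => x _.
rewrite mulr_suml !mulr_sumr; apply: eq_bigr => y _.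
by rewrite !mulr_sumr; apply: eq_bigr => z _; rewrite (mulrA (F x)).
Qed.

Lemma bin_leq_exp (n k : nat) : ('C(n, k) <= n ^ k)%N.
Proof.
elim: k n => [|k IHk] [|n] //; rewrite -(leq_pmul2l (ltn0Sn k)) -mul_bin_diag expnS.
apply: leq_trans (_ : n.+1 * n.+1 ^ k <= _)%N; last by rewrite leq_pmull.
rewrite leq_mul2l; apply/orP; right; apply: leq_trans (IHk n) _.
by case: k {IHk} => // k; rewrite leq_exp2r.
Qed.

Notation sizes q := ('I_q.+1 * 'I_q.+1 * 'I_q.+1 * 'I_q.+1)%type.

Section Slices.
Variables (U : finType) (q : nat).
Implicit Types (f g h : qset U q -> int) (T P Q R : {set U}).

Definition slice f T P Q : int := \sum_(A : qset U q | fits T P Q (val A)) f A.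

(** A slice is either zero or a sum that depends only on the union of the three sets. One table of
    superset sums, indexed by a single set, therefore supplies all slices without further
    operations. *)
Lemma sliceE f T P Q : slice f T P Q =
  if [&& [disjoint T & P], [disjoint T & Q] & [disjoint P & Q]]
  then \sum_(A : qset U q | T :|: P :|: Q \subset val A) f A else 0.
Proof.
rewrite /slice; case: ifP => [/and3P[TP TQ PQ]|dF].
  by apply: eq_bigl => A; rewrite /fits TP TQ PQ.
rewrite big_pred0 // => A; apply/negP => /and4P[TP TQ PQ _].
by rewrite TP TQ PQ in dF.
Qed.

Lemma slice_eq0 f T P Q : (q < #|T| + #|P| + #|Q|)%N -> slice f T P Q = 0.
Proof.
move=> lt_q; rewrite /slice big_pred0 // => A.
apply/negP => /and4P[/disjoint_setI0 TP /disjoint_setI0 TQ /disjoint_setI0 PQ].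
move=> /subset_leq_card; rewrite (eqP (valP A)).
by rewrite !cardsU finset.setIUl TP TQ PQ finset.setU0 !cards0 !subn0 leqNgt lt_q.
Qed.

Lemma Delta_expansion f g h : Delta f g h =
  \sum_(T : {set U}) \sum_(P : {set U}) \sum_(Q : {set U}) \sum_(R : {set U})
    coef #|T| #|P| #|Q| #|R| *
      (slice f T P Q * slice g T P R * slice h T Q R).
Proof.
rewrite !pair_bigA /=.
under [RHS]eq_bigr => x _.
  rewrite /slice big_mkcond [X in _ * X * _]big_mkcond [X in _ * _ * X]big_mkcond /=.
  rewrite mulr_sum3.
  over.
(* With A, B, C moved outside, the remaining sum is the expansion of their disjointness. *)
rewrite exchange_big; apply: eq_bigr => A _ /=.
rewrite exchange_big; apply: eq_bigr => B _ /=.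
rewrite exchange_big /= big_mkcond; apply: eq_bigr => C _ /=.
transitivity (f A * g B * h C * [&& [disjoint val A & val B],
   [disjoint val A & val C] & [disjoint val B & val C]]%:R).
  by case: ifP; rewrite ?mulr1 ?mulr0.
rewrite disjoint_expansion !pair_bigA mulr_sumr /=; apply: eq_bigr => x _.
do 3 case: ifP => _; rewrite ?(mul0r, mulr0) // !mulr1 mulrC //.
Qed.

(** Here p, r, s are the sizes of P, Q, R. If one of the inequalities fails, [slice_eq0] kills a
    factor. If all hold, any two of p, r, s add up to at most q - t, which is what bounds the matrix
    dimensions. *)
Definition size_ok (t p r s : nat) : bool :=
  [&& t + p + r <= q, t + p + s <= q & t + r + s <= q]%N.

Definition size_term f g h (k : sizes q) : int :=
  let: (t, p, r, s) := k in
  coef t p r s * \sum_(T : {set U} | #|T| == t) \sum_(P : {set U} | #|P| == p)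
    \sum_(Q : {set U} | #|Q| == r) \sum_(R : {set U} | #|R| == s)
      slice f T P Q * slice g T P R * slice h T Q R.

Definition admissible (k : sizes q) : bool :=
  let: (t, p, r, s) := k in size_ok t p r s.

Lemma Delta_sizes f g h : Delta f g h = \sum_(k | admissible k) size_term f g h k.
Proof.
rewrite Delta_expansion !pair_bigA /=.
pose c (x : {set U} * {set U} * {set U} * {set U}) :=
  size_ok #|x.1.1.1| #|x.1.1.2| #|x.1.2| #|x.2|.
rewrite (bigID c) /= [X in _ + X]big1 ?addr0; last first.
  move=> x; rewrite /c /size_ok !negb_and -!ltnNge => /or3P[] /slice_eq0 ->;
  by rewrite ?(mul0r, mulr0).
(* Under [c] all four sizes are at most q, so [inord] keeps them unchanged; the other tuples have
   already been discarded. *)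
pose sz (x : {set U} * {set U} * {set U} * {set U}) : sizes q :=
  (inord #|x.1.1.1|, inord #|x.1.1.2|, inord #|x.1.2|, inord #|x.2|).
have szE x : c x -> [/\ (sz x).1.1.1 = #|x.1.1.1| :> nat,
    (sz x).1.1.2 = #|x.1.1.2| :> nat, (sz x).1.2 = #|x.1.2| :> nat &
    (sz x).2 = #|x.2| :> nat].
  rewrite /c /size_ok /sz /= => /and3P[? ? ?].
  by split; apply: inordK; lia.
have admE k : admissible k = size_ok k.1.1.1 k.1.1.2 k.1.2 k.2 by case: k => -[[]].
rewrite (partition_big sz admissible) => [|x cx]; last first.
  by rewrite admE; have [-> -> -> ->] := szE x cx.
apply: eq_bigr => -[[[t p] r] s] /= adm_k.
rewrite !pair_big_dep /= mulr_sumr; apply: eq_big => [x|x /andP[cx /eqP sx]].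
  apply/andP/idP => [[/szE[+ + + +] /eqP sx]|].
    by rewrite sx /= => -> -> -> ->; rewrite !eqxx.
  case: x => -[[T P] Q] R /= /andP[/andP[/andP[]]] /eqP Tt /eqP Pp /eqP Qr /eqP Rs.
  by rewrite /c /= Tt Pp Qr Rs; split=> //; rewrite /sz /= Tt Pp Qr Rs !inord_val.
by have [] := szE x cx; rewrite sx /= => -> -> -> ->.
Qed.

End Slices.

(** * The program and its operation count *)

Section Algorithm.
Variable P0 : forall N M : nat, slp (mx_input N M) ('I_N * 'I_N).
Hypothesis P0P : forall N M, (N <= M)%N -> computes (P0 N M) (@mx_product N M).

Definition mm_cost (n m M : nat) : nat :=
  (cost (P0 (n ^ m) (n ^ M)) + 2 * (n ^ m) ^ 2)%N.

(** Summing over all shapes with m <= M and m + M <= k gives a common bound for every triangle of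
    sizes allowed by k. The number of shapes depends on k only, so the order of growth is that of
    the costliest one. *)
Definition tri_cost (n k : nat) : nat :=
  (\sum_(M < k.+1) \sum_(m < k.+1 | (m <= M) && (m + M <= k)) mm_cost n m M)%N.

Lemma mm_cost_le n k m M : (m <= M)%N -> (m + M <= k)%N ->
  (mm_cost n m M <= tri_cost n k)%N.
Proof.
move=> mM mMk; have ltM : (M < k.+1)%N by lia.
have ltm : (m < k.+1)%N by lia.
rewrite /tri_cost (bigD1 (Ordinal ltM)) //= (bigD1 (Ordinal ltm)) /=;
  last by rewrite mM.
by rewrite -addnA leq_addr.
Qed.

Section Fixed.
Variables (U : finType) (I : Type) (S : set ((I -> int) -> int)).
(* The maximum keeps n ^ m <= n ^ M for m <= M when U is empty. *)
Let n := maxn 1 #|U|.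
Hypothesis S0 : S (fun=> 0).

Lemma card_ksets k m : (k <= m)%N ->
  (size (enum [set P : {set U} | #|P| == k]) <= n ^ m)%N.
Proof.
move=> km; rewrite -cardE card_draws.
apply: leq_trans (_ : n ^ k <= _)%N; last by rewrite leq_pexp2l // leq_max.
apply: leq_trans (bin_leq_exp _ _) _.
by case: k {km} => // k; rewrite leq_exp2r // leq_maxr.
Qed.

Lemma makes_size_triangle (a b c : {set U} -> {set U} -> (I -> int) -> int) k p r s :
  (p + r <= k)%N -> (p + s <= k)%N -> (r + s <= k)%N ->
  (forall P Q, S (a P Q)) -> (forall P R, S (b P R)) -> (forall Q R, S (c Q R)) ->
  makes S (tri_cost n k)
   [set fun v => \sum_(P : {set U} | #|P| == p) \sum_(Q : {set U} | #|Q| == r)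
     \sum_(R : {set U} | #|R| == s) a P Q v * b P R v * c Q R v]%classic.
Proof.
pose e i := enum [set P : {set U} | #|P| == i].
have eE (F : {set U} -> int) i :
    \sum_(P : {set U} | #|P| == i) F P = \sum_(P <- e i) F P.
  by rewrite big_enum /=; apply: eq_bigl => P; rewrite inE.
(* The case where the first size x is the largest: it indexes the inner dimension n^x, and the
   larger of y and z gives the outer dimension. *)
have main x y z (a' b' c' : {set U} -> {set U} -> (I -> int) -> int) :
    (y <= x)%N -> (z <= x)%N -> (x + y <= k)%N -> (x + z <= k)%N ->
    (forall P Q, S (a' P Q)) -> (forall P R, S (b' P R)) ->
    (forall Q R, S (c' Q R)) ->
    makes S (tri_cost n k) [set fun v => \sum_(P <- e x) \sum_(Q <- e y)
      \sum_(R <- e z) a' P Q v * b' P R v * c' Q R v]%classic.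
  move=> yx zx xy xz Sa Sb Sc; pose m := maxn y z.
  have cP : computes (P0 (n ^ m) (n ^ x)) (@mx_product _ _).
    by apply: P0P; rewrite leq_pexp2l ?leq_max // geq_max yx.
  have := makes_triangle cP (card_ksets (leqnn x)) (card_ksets (leq_maxl y z))
    (card_ksets (leq_maxr y z)) S0 Sa Sb Sc.
  by apply: makes_sub => //; apply: mm_cost_le; rewrite /m; lia.
move=> pr ps rs Sa Sb Sc.
pose tri v := \sum_(P <- e p) \sum_(Q <- e r) \sum_(R <- e s)
  a P Q v * b P R v * c Q R v.
have -> : (fun v => \sum_(P : {set U} | #|P| == p) \sum_(Q : {set U} | #|Q| == r)
     \sum_(R : {set U} | #|R| == s) a P Q v * b P R v * c Q R v) = tri.
  apply/funext => v; rewrite /tri eE; apply: eq_bigr => P _; rewrite eE.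
  by apply: eq_bigr => Q _; rewrite eE.
have [/andP[rp sp]|] := boolP ((r <= p) && (s <= p))%N; first exact: main.
(* Otherwise r or s is the largest; the sums are reordered so that it comes first, and the three
   functions change roles accordingly. *)
rewrite negb_and -!ltnNge => pmax; have [sr|rs'] := leqP s r.
  have -> : tri = fun v => \sum_(Q <- e r) \sum_(P <- e p) \sum_(R <- e s)
      a P Q v * c Q R v * b P R v.
    apply/funext => v; rewrite /tri exchange_big; apply: eq_bigr => Q _.
    apply: eq_bigr => P _.
    by apply: eq_bigr => R _; rewrite mulrAC.
  by apply: (main r p s (fun Q P => a P Q) c b) => //; lia.
have -> : tri = fun v => \sum_(R <- e s) \sum_(P <- e p) \sum_(Q <- e r)
    b P R v * c Q R v * a P Q v.
  apply/funext => v; rewrite [RHS]exchange_big; apply: eq_bigr => P _.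
  rewrite [RHS]exchange_big; apply: eq_bigr => Q _.
  by apply: eq_bigr => R _; rewrite [RHS]mulrC mulrA.
by apply: (main s p r (fun R P => b P R) (fun R Q => c Q R) a) => //; lia.
Qed.

End Fixed.

(** The summands count the triangles for all T of size t, the additions over T, the constant
    [coef t p r s], and the multiplication by it. *)
Definition size_term_cost (n q : nat) (k : sizes q) : nat :=
  let: (t, p, r, s) := k in
  (n ^ t * tri_cost n (q - t) + n ^ t + `|coef t p r s|.+1 + 1)%N.

Definition triples_cost (n q : nat) : nat :=
  (1 + (3 * (2 ^ q * n ^ q) +
    (\sum_(k | @admissible q k) size_term_cost n k + q.+1 ^ 4)))%N.

Variables (U : finType) (q : nat).
Let n := maxn 1 #|U|.

(** There are 2^#|U| sets T, but T costs only one addition per q-set containing it, hence nothing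
    when it has more than q elements. Counting pairs from the side of A, each q-set has 2^q subsets,
    which gives the bound 2^q n^q. *)
Lemma makes_zeta (I : Type) (S : set ((I -> int) -> int)) (inj : qset U q -> I) :
  S (fun=> 0) -> (forall A, S (fun v => v (inj A))) ->
  makes S (2 ^ q * n ^ q) (range (fun T : {set U} =>
    fun v => \sum_(A : qset U q | T \subset val A) v (inj A)))%classic.
Proof.
move=> S0 Sin.
pose s (T : {set U}) := enum [pred A : qset U q | T \subset val A].
have := @makes_family _ _ S (enum {: {set U}}) (fun T => size (s T)) (fun T =>
  fun v => \sum_(A : qset U q | T \subset val A) v (inj A)).
move=> K; apply: (makes_sub _ _ _ (K _)) => //.
- rewrite big_enum /=.
  rewrite (eq_bigr (fun T : {set U} => \sum_(A : qset U q | T \subset val A) 1)%N);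
    last by move=> T _; rewrite -cardE sum1_card.
  rewrite (exchange_big_dep predT) //=.
  rewrite (eq_bigr (fun=> 2 ^ q)%N) => [|A _]; last first.
    rewrite sum1_card -[in RHS](eqP (valP A)) -card_powerset; apply: eq_card => T.
    by rewrite !inE.
  rewrite sum_nat_const mulnC leq_mul2l; apply/orP; right.
  by rewrite card_sig -cardsE; have := card_ksets U (leqnn q); rewrite -cardE.
- by move=> F [T _ <-]; exists T; rewrite //= mem_enum.
move=> T _.
have -> : (fun v : I -> int => \sum_(A : qset U q | T \subset val A) v (inj A))
    = fun v => \sum_(A <- s T) v (inj A).
  by apply/funext => v; rewrite big_enum.
exact: makes_sum.
Qed.

Lemma makes_size_term (I : Type) (S : set ((I -> int) -> int))
    (f g h : (I -> int) -> qset U q -> int) k :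
  admissible k -> S (fun=> 0) ->
  (forall T P Q, S (fun v => slice (f v) T P Q)) ->
  (forall T P Q, S (fun v => slice (g v) T P Q)) ->
  (forall T P Q, S (fun v => slice (h v) T P Q)) ->
  makes S (size_term_cost n k) [set fun v => size_term (f v) (g v) (h v) k]%classic.
Proof.
case: k => -[[t p] r] s /and3P[tpr tps trs] S0 Sf Sg Sh.
rewrite /size_term_cost /size_term.
pose sT := enum [set T : {set U} | #|T| == t].
pose tri (T : {set U}) (v : I -> int) :=
  \sum_(P : {set U} | #|P| == p) \sum_(Q : {set U} | #|Q| == r)
  \sum_(R : {set U} | #|R| == s)
    slice (f v) T P Q * slice (g v) T P R * slice (h v) T Q R.
have szT : (size sT <= n ^ t)%N by apply: card_ksets.
have -> : (fun v => coef t p r s * \sum_(T : {set U} | #|T| == t) tri T v) =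
    fun v => coef t p r s * \sum_(T <- sT) tri T v.
  apply/funext => v; rewrite big_enum /=; congr (_ * _).
  by apply: eq_bigl => T; rewrite inE.
apply: (@makes_trans _ _ _ ([set fun v => (\sum_(T <- sT) tri T v)%R] `|`
    [set fun=> coef t p r s : int])%classic); last first.
  by apply: makes_mul; right; [right | left].
apply: makes_seq; last by apply: makes_const; left.
apply: (@makes_trans _ _ _ [set tri T | T in [set` sT]]%classic).
  have := @makes_family _ _ S sT (fun=> tri_cost n (q - t)) tri.
  move=> K; apply: (makes_sub _ _ _ (K _)) => //.
    by rewrite big_const_seq count_predT iter_addn_0 mulnC leq_mul2r szT orbT.
  by move=> T _; apply: makes_size_triangle => //; lia.
have K := @makes_sum I _ (S `|` [set tri T | T in [set` sT]])%classic sT tri.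
by apply: makes_sub (K _ _) => // [|T sT']; [left | right; exact: imageP].
Qed.

Lemma makes_triples : makes set0 (triples_cost n q)
  [set fun v : triples_input U q -> int => triples_problem v tt]%classic.
Proof.
pose I := triples_input U q.
pose zeta (inj : qset U q -> I) (T : {set U}) (v : I -> int) :=
  \sum_(A : qset U q | T \subset val A) v (inj A).
pose jf A : I := inl (inl A); pose jg A : I := inl (inr A); pose jh A : I := inr A.
pose f (v : I -> int) A := v (jf A); pose g (v : I -> int) A := v (jg A).
pose h (v : I -> int) A := v (jh A).
rewrite /triples_cost.
apply: (@makes_trans _ _ _ [set fun=> 0 : int]%classic); first exact: makes_zero.
pose Z : set ((I -> int) -> int) :=
  (range (zeta jf) `|` range (zeta jg) `|` range (zeta jh))%classic.
apply: (@makes_trans _ _ _ Z).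
  apply: makes_input; rewrite mulSn mulSn mul1n addnA.
  have mZ inj S : S (fun=> 0) -> (forall A, S (fun v => v (inj A))) ->
    makes S (2 ^ q * n ^ q) (range (zeta inj)) by apply: makes_zeta.
  apply: makes_seq; first apply: makes_seq.
  - by apply: mZ => [|A]; [left; right | right; exists (jf A)].
  - by apply: mZ => [|A]; left; [left; right | right; exists (jg A)].
  - by apply: mZ => [|A]; left; [left; right | right; exists (jh A)].
set S := (set0 `|` _ `|` Z)%classic.
have S0 : S (fun=> 0) by left; right.
(* By [sliceE] each slice is already available, as an entry of the superset table or as the zero
   function. *)
have Sslice inj : (forall T, S (zeta inj T)) ->
    forall T P Q, S (fun v => slice (fun A => v (inj A)) T P Q).
  move=> Sz T P Q.
  have := Sz (T :|: P :|: Q); rewrite /zeta.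
  have [dT|dF] := boolP [&& [disjoint T & P], [disjoint T & Q] & [disjoint P & Q]].
    by congr S; apply/funext => v; rewrite sliceE dT.
  move=> _; move: S0; congr S; apply/funext => v; rewrite sliceE (negbTE dF) //.
pose s := enum [pred k | @admissible q k].
pose tm k v := size_term (f v) (g v) (h v) k.
apply: (@makes_trans _ _ _ [set tm k | k in [set` s]]%classic).
  have := @makes_family I _ S s (@size_term_cost n q) tm.
  move=> K; apply: (makes_sub _ _ _ (K _)) => //.
    by rewrite /s big_enum.
  move=> k; rewrite mem_enum => adm_k.
  apply: makes_size_term => //; apply: Sslice => T.
  - by right; left; left; exists T.
  - by right; left; right; exists T.
  - by right; right; exists T.
have -> : (fun v : I -> int => triples_problem v tt) =
    fun v => \sum_(k <- s) tm k v.
  by apply/funext => v; rewrite /triples_problem Delta_sizes big_enum.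
have K := @makes_sum I _ (S `|` [set tm k | k in [set` s]])%classic s tm.
apply: makes_sub (K _ _) => // [|| k sk]; [|by left|by right; exact: imageP].
rewrite -cardE; apply: leq_trans (max_card _) _.
by rewrite !card_prod !card_ord; lia.
Qed.

End Algorithm.

(** * Asymptotic estimate of the operation count *)

Section Growth.
Variable R : realType.
Implicit Types (e w : R) (c d : nat -> nat).

Definition bigO e c : Prop :=
  exists C : R, forall n, (0 < n)%N -> (c n)%:R <= C * n%:R `^ e.

Lemma bigO_le e e' c : e <= e' -> bigO e c -> bigO e' c.
Proof.
move=> le_e [C cP]; exists `|C| => n n0; apply: le_trans (cP n n0) _.
apply: le_trans (_ : `|C| * n%:R `^ e <= _).
  by rewrite ler_wpM2r ?powR_ge0 // ler_norm.
by rewrite ler_wpM2l // ler_powR // ler1n.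
Qed.

Lemma bigO_add e c d : bigO e c -> bigO e d -> bigO e (fun n => c n + d n)%N.
Proof.
move=> [C cP] [D dP]; exists (C + D) => n n0.
by rewrite natrD mulrDl lerD ?cP ?dP.
Qed.

Lemma bigO_mulX e c k : bigO e c -> bigO (k%:R + e) (fun n => n ^ k * c n)%N.
Proof.
move=> [C cP]; exists C => n n0.
rewrite natrM natrX powRD; last by rewrite pnatr_eq0 -lt0n n0 implybT.
by rewrite powR_mulrn // mulrCA ler_wpM2l ?exprn_ge0 // cP.
Qed.

Lemma bigO_const e k : 0 <= e -> bigO e (fun=> k).
Proof.
move=> e0; apply: bigO_le e0 _; exists k%:R => n n0.
by rewrite powRr0 mulr1.
Qed.

Lemma bigO_exp e k : k%:R <= e -> bigO e (fun n => n ^ k)%N.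
Proof.
move=> ke; apply: bigO_le ke _; exists 1 => n n0.
by rewrite natrX powR_mulrn // mul1r.
Qed.

Lemma bigO_sum (J : finType) (P : pred J) e (c : J -> nat -> nat) :
  (0 <= e) -> (forall j, P j -> bigO e (c j)) ->
  bigO e (fun n => \sum_(j | P j) c j n)%N.
Proof.
move=> e0 cP.
have -> : (fun n => \sum_(j | P j) c j n)%N =
    \big[(fun c d n => c n + d n)%N/fun=> 0%N]_(j | P j) c j.
  apply/funext => n.
  by apply: (big_ind2 (fun x (d : nat -> nat) => x = d n)) => // _ c1 _ d1 -> ->.
by elim/big_ind: _ => // [|c1 d1]; [exact: bigO_const | exact: bigO_add].
Qed.

Lemma bigO_scale e k c : bigO e c -> bigO e (fun n => k * c n)%N.
Proof.
move=> [C cP]; exists (k%:R * C) => n n0.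
by rewrite natrM -mulrA ler_wpM2l // cP.
Qed.

Variable w : R.
Hypothesis w2 : 2 <= w.

Lemma disjoint_triples_rect q : rect_mm_in w ->
  disjoint_triples_in q (q%:R + (q./2)%:R * (w - 2)).
Proof.
move=> [C [P0 mmP]].
have P0P N M : (N <= M)%N -> computes (P0 N M) (@mx_product N M).
  by move=> /mmP[].
have P0c N M : (0 < N)%N -> (N <= M)%N ->
    (cost (P0 N M))%:R <= C * (N%:R `^ (w - 1) * M%:R).
  by move=> N0 /mmP[_]; apply.
have mmO m M : (m <= M)%N ->
    bigO ((m + M)%:R + m%:R * (w - 2)) (fun n => mm_cost P0 n m M).
  move=> mM; apply: bigO_add.
    exists C => n n0; apply: le_trans (P0c _ _ _ _) _; rewrite ?expn_gt0 ?n0 //.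
      by rewrite leq_pexp2l.
    rewrite !natrX -!powR_mulrn // -powRrM -powRD;
      last by rewrite pnatr_eq0 -lt0n n0 implybT.
    rewrite (_ : m%:R * (w - 1) + M%:R = (m + M)%:R + m%:R * (w - 2)) //.
    by rewrite natrD; ring.
  (* Weighting and adding the entries of the product takes 2 n^(2m) operations, which is dominated
     because 2m <= m + M and w >= 2. *)
  apply: bigO_scale; rewrite (_ : (fun n => _) = fun n => n ^ (m * 2))%N; last first.
    by apply/funext => n; rewrite expnM.
  apply: bigO_exp; rewrite muln2 -addnn; apply: ler_wpDr.
    by rewrite mulr_ge0 // subr_ge0.
  by rewrite ler_nat leq_add2l.
set e := q%:R + _.
have half_le i : (i <= q./2)%N -> i%:R * (w - 2) <= (q./2)%:R * (w - 2).
  by move=> iq; rewrite ler_wpM2r ?subr_ge0 // ler_nat.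
have qe : q%:R <= e by rewrite lerDl mulr_ge0 // subr_ge0.
have e0 : 0 <= e by apply: le_trans qe.
have triO t : (t <= q)%N -> bigO e (fun n => n ^ t * tri_cost P0 n (q - t))%N.
  move=> tq; apply: (@bigO_le (t%:R + ((q - t)%:R + (q./2)%:R * (w - 2)))).
    by rewrite addrA -natrD subnKC.
  apply: bigO_mulX; apply: bigO_sum => [|M _].
    by rewrite addr_ge0 // mulr_ge0 // subr_ge0.
  apply: bigO_sum => [|m /andP[mM mMq]].
    by rewrite addr_ge0 // mulr_ge0 // subr_ge0.
  apply: bigO_le (mmO _ _ mM); apply: lerD; first by rewrite ler_nat.
  (* From m <= M and m + M <= q - t follows 2m <= q, so m is at most the integer half of q. *)
  by apply: half_le; lia.
have [K KP] : bigO e (fun n => triples_cost P0 n q).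
  apply: bigO_add; first exact: bigO_const.
  apply: bigO_add; first by do 2 apply: bigO_scale; exact: bigO_exp.
  apply: bigO_add; last exact: bigO_const.
  apply: bigO_sum => // -[[[t p] r] s] _; rewrite /size_term_cost.
  have tq : (t <= q)%N by rewrite -ltnS ltn_ord.
  apply: bigO_add; last exact: bigO_const.
  apply: bigO_add; last exact: bigO_const.
  apply: bigO_add; first exact: triO.
  by apply: bigO_exp; apply: le_trans qe; rewrite ler_nat.
(* The programs are only known to exist, so one is chosen for each U. *)
have exP U : {P : slp (triples_input U q) unit |
    computes P (@triples_problem U q) /\
    (cost P <= triples_cost P0 (maxn 1 #|U|) q)%N}.
  apply: cid; have [P PP cP] := makes_slp (makes_triples P0P (U := U) (q := q)).
  by exists P; split=> // x; have [regs runP outP] := PP x; exists regs => // -[].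
exists K, (fun U => sval (exP U)) => n U nU.
case: (svalP (exP U)) => PP cP; split=> // n0.
apply: le_trans (KP n n0); rewrite ler_nat; apply: leq_trans cP _.
by rewrite nU (maxn_idPr n0).
Qed.

End Growth.

Theorem theorem2 (R : realType)
  (omega_bounds :
     2 <= omega R < 2 + 372 / 10 ^+ 3 + 863 / 10 ^+ 6 + 9 / 10 ^+ 7)
  (square_mm : square_mm_in (omega R))
  (rect_mm : rect_mm_in (omega R)) :
  [/\ disjoint_triples_in 2 (omega R),
      disjoint_triples_in 3 (omega R + 1)
    & disjoint_triples_in 4 (2 * omega R)].
Proof.
have /andP[w2 _] := omega_bounds.
have triples q e : e = q%:R + (q./2)%:R * (omega R - 2) -> disjoint_triples_in q e.
  by move=> ->; apply: disjoint_triples_rect.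
(* The exponents are 2 + (w - 2) = w, 3 + (w - 2) = w + 1 and 4 + 2(w - 2) = 2w, with w standing for
   [omega R]. *)
by split; apply: triples => /=; ring.
Qed.
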